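(* Let $(u_n)_{n=0}^{\infty}$ be a sequence of real numbers that is bounded from below and satisfies $\inf\{u_n\}<u_0$, where $\inf\{u_n\}$ is the infimum of $u_n$ over all $n\in\mathbb{N}\cup\{0\}$. Then there exists a non-constant convex sequence $(v_n)_{n=0}^{\infty}$ such that $\inf\{u_n\}\le v_n\le u_n$ for all $n\in\mathbb{N}\cup\{0\}$.
   Context: $\mathbb{N}$ denotes the set of positive integers. A real sequence $(v_n)_{n=0}^{\infty}$ is called convex if $2v_n\le v_{n-1}+v_{n+1}$ for all $n\in\mathbb{N}$. The symbol $\{u_n\}$ denotes the range set of the sequence $(u_n)_{n=0}^{\infty}$. *)

(* Defs.v *)
From mathcomp Require Import all_boot all_order all_algebra.
From mathcomp Require Import classical_sets reals.

Set Implicit Arguments.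
Unset Strict Implicit.
Unset Printing Implicit Defensive.

Import Order.TTheory GRing.Theory Num.Theory.
Local Open Scope ring_scope.

Definition convex_seq (R : realType) (v : nat -> R) : Prop :=
  forall n : nat, (0 < n)%N -> 2 * v n <= v n.-1 + v n.+1.

Definition constant_seq (R : realType) (v : nat -> R) : Prop :=
  exists c : R, forall n : nat, v n = c.

(* Main.v *)
Require Import Defs.
From mathcomp Require Import all_boot all_order all_algebra.
From mathcomp Require Import classical_sets reals.

Import Order.TTheory GRing.Theory Num.Theory.
Local Open Scope ring_scope.
Local Open Scope classical_set_scope.

(** A single strict drop already makes a sequence convex and non-constant: keep
    the value [u 0] at [0] and take the infimum everywhere after it. Convexity
    can only be at stake where the slope changes, at [n = 1], and there the
    slope increases from a negative number to [0]. *)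
Theorem proposition2p1 (R : realType) (u : nat -> R)
    (u_bounded_below : has_lbound (range u))
    (inf_lt_u0 : inf (range u) < u 0%N) :
  exists v : nat -> R,
    [/\ convex_seq v, ~ constant_seq v
      & forall n : nat, inf (range u) <= v n <= u n].
Proof.
exists (fun n => if n is 0%N then u 0%N else inf (range u)); split.
- case=> [//|[|n]] _ /=; rewrite mulr_natl mulr2n //.
  by rewrite lerD2r ltW.
- case=> c vc; move: inf_lt_u0.
  by rewrite (vc 0%N) (vc 1%N) ltxx.
- case=> [|n]; first by rewrite lexx ltW.
  by rewrite lexx ge_inf //; exists n.+1.
Qed.
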